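(* Let $G=(V,E)$ be a tree with uncertainty intervals $I_f=[\ell_f,h_f]$ on its edges, and consider the maximum weight matching problem. For a fixed edge $e\in E$, both the infimum and the supremum of $T_e(w_{-e})$ over all $w_{-e}\in\prod_{f\in E\setminus\{e\}}I_f$ (the thresholds of inclusion and exclusion of $e$) can be computed in time linear in the size of the tree.
   Context: The feasible sets are the matchings of $G$ (sets of pairwise disjoint edges), and the goal is to maximize $w(M)=\sum_{f\in M}w_f$. For an edge $e$ and $w_{-e}\in\mathbb{R}^{E\setminus\{e\}}$, let $M^{-e}(w_{-e})$ be the maximum weight of a matching not containing $e$ and $M^{+e}(w_{-e})$ the maximum weight of a matching containing $e$ with $w_e$ set to $0$; the threshold is $T_e(w_{-e})=M^{-e}(w_{-e})-M^{+e}(w_{-e})$, so that $e$ lies in every maximum weight matching when $w_e>T_e(w_{-e})$ and in none when $w_e<T_e(w_{-e})$. *)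

(* Defs.v *)
From HB Require Import structures.
From mathcomp Require Import all_boot all_order all_algebra.
From mathcomp Require Import all_classical all_reals.

Set Implicit Arguments.
Unset Strict Implicit.
Unset Printing Implicit Defensive.

Import Order.TTheory GRing.Theory Num.Theory.

Local Open Scope ring_scope.

(* A graph on the finite type V is given by its edge set, an edge being the
   set of its two endpoints. *)
Section Graphs.
Variable V : finType.
Implicit Types E M : {set {set V}}.

Definition simple_graph E : Prop := forall f : {set V}, f \in E -> #|f| = 2%N.

Definition adj E : rel V := fun x y => [set x; y]%SET \in E.

(* [ucycle] also accepts [:: x; y] for every edge xy, hence the bound 2. *)
Definition acyclic E : Prop :=
  forall c : seq V, ucycle (adj E) c -> (size c <= 2)%N.

Definition is_tree E : Prop :=
  [/\ simple_graph E, (0 < #|V|)%N, (forall x y : V, connect (adj E) x y)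
    & acyclic E].

Definition matching E M : bool := (M \subset E) && finset.trivIset M.

End Graphs.

Section Threshold.
Variables (R : realType) (V : finType).
Implicit Types (E M : {set {set V}}) (e : {set V}) (w l h : {set V} -> R).

Definition weight w M : R := \sum_(f in M) w f.

(* The default value 0 of the two maxima below is harmless: it is the weight
   of the matching set0 in the first one and, when e is an edge, of the
   matching [set e] in the second one. *)
Definition max_without E e w : R :=
  \big[Num.max/0]_(M : {set {set V}} | matching E M && (e \notin M)) weight w M.

Definition max_with E e w : R :=
  \big[Num.max/0]_(M : {set {set V}} | matching E M && (e \in M))
     weight (fun f => if f == e then 0 else w f) M.

(* Vectors indexed by E minus e are represented by total functions; the value
   of w at e and outside E plays no role. *)
Definition threshold E e w : R := max_without E e w - max_with E e w.

Definition realizations E e l h : set ({set V} -> R) :=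
  [set w | forall f : {set V}, f \in (E :\ e)%SET -> l f <= w f <= h f]%classic.

Definition thresholds E e l h : set R :=
  [set threshold E e w | w in realizations E e l h]%classic.

End Threshold.

(* The memory consists of integer arrays and real arrays, both named by
   natural numbers.  Integers are used for addressing; reals can only be
   added, subtracted and compared, and cannot be converted to integers. *)

Inductive iexp : Type :=
  | IConst of nat
  | IRead of nat & iexp          (* array name, index *)
  | IAdd of iexp & iexp
  | ISub of iexp & iexp.         (* truncated at 0 *)

Inductive rexp : Type :=
  | RZero
  | RRead of nat & iexp
  | RAdd of rexp & rexp
  | RSub of rexp & rexp.

Inductive bexp : Type :=
  | ILe of iexp & iexp
  | RLe of rexp & rexp
  | BNot of bexp
  | BAnd of bexp & bexp.

Inductive cmd : Type :=
  | Skip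
  | IAssign of nat & iexp & iexp (* array name, index, value *)
  | RAssign of nat & iexp & rexp
  | Seq of cmd & cmd
  | If of bexp & cmd & cmd
  | While of bexp & cmd.

Fixpoint icost (a : iexp) : nat :=
  match a with
  | IConst _ => 1
  | IRead _ i => (icost i).+1
  | IAdd a1 a2 | ISub a1 a2 => (icost a1 + icost a2).+1
  end.

Fixpoint rcost (a : rexp) : nat :=
  match a with
  | RZero => 1
  | RRead _ i => (icost i).+1
  | RAdd a1 a2 | RSub a1 a2 => (rcost a1 + rcost a2).+1
  end.

Fixpoint bcost (b : bexp) : nat :=
  match b with
  | ILe a1 a2 => (icost a1 + icost a2).+1
  | RLe a1 a2 => (rcost a1 + rcost a2).+1
  | BNot b1 => (bcost b1).+1
  | BAnd b1 b2 => (bcost b1 + bcost b2).+1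
  end.

Definition upd (T : Type) (m : nat -> nat -> T) (x i : nat) (v : T) :
    nat -> nat -> T :=
  fun y j => if (y == x) && (j == i) then v else m y j.

Section Semantics.
Variable R : realType.

Record state : Type := State {
  imem : nat -> nat -> nat;
  rmem : nat -> nat -> R
}.

Implicit Types s : state.

Fixpoint ieval s (a : iexp) : nat :=
  match a with
  | IConst k => k
  | IRead x i => imem s x (ieval s i)
  | IAdd a1 a2 => (ieval s a1 + ieval s a2)%N
  | ISub a1 a2 => (ieval s a1 - ieval s a2)%N
  end.

Fixpoint reval s (a : rexp) : R :=
  match a with
  | RZero => 0
  | RRead x i => rmem s x (ieval s i)
  | RAdd a1 a2 => reval s a1 + reval s a2
  | RSub a1 a2 => reval s a1 - reval s a2
  end.

Fixpoint beval s (b : bexp) : bool :=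
  match b with
  | ILe a1 a2 => (ieval s a1 <= ieval s a2)%N
  | RLe a1 a2 => reval s a1 <= reval s a2
  | BNot b1 => ~~ beval s b1
  | BAnd b1 b2 => beval s b1 && beval s b2
  end.

(* [exec B c s t s']: started in s, the program c halts in state s' after t
   elementary operations, without storing an integer greater than B.  Taking B
   polynomial in the input size restricts integers to logarithmically many
   bits, which justifies charging one unit per integer operation. *)
Inductive exec (B : nat) : cmd -> state -> nat -> state -> Prop :=
  | ESkip s : exec B Skip s 1 s
  | EIAssign x i a s :
      (ieval s a <= B)%N ->
      exec B (IAssign x i a) s (icost i + icost a).+1
        (State (upd (imem s) x (ieval s i) (ieval s a)) (rmem s))
  | ERAssign x i a s :
      exec B (RAssign x i a) s (icost i + rcost a).+1
        (State (imem s) (upd (rmem s) x (ieval s i) (reval s a)))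
  | ESeq c1 c2 s1 t1 s2 t2 s3 :
      exec B c1 s1 t1 s2 -> exec B c2 s2 t2 s3 ->
      exec B (Seq c1 c2) s1 (t1 + t2) s3
  | EIf b c1 c2 s t s' :
      exec B (if beval s b then c1 else c2) s t s' ->
      exec B (If b c1 c2) s (bcost b + t) s'
  | EWhileFalse b c s :
      ~~ beval s b -> exec B (While b c) s (bcost b) s
  | EWhileTrue b c s1 t1 s2 t2 s3 :
      beval s1 b -> exec B c s1 t1 s2 -> exec B (While b c) s2 t2 s3 ->
      exec B (While b c) s1 (bcost b + t1 + t2) s3.

End Semantics.

Section Encoding.
Variables (R : realType) (n : nat).
Implicit Types (s : seq ('I_n * 'I_n)) (E : {set {set 'I_n}}).

Definition edges_of s : seq {set 'I_n} := [seq [set p.1; p.2]%SET | p <- s].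

(* Every edge is listed exactly once; the order of the list and the order of
   the two endpoints of each edge are arbitrary. *)
Definition edge_list E s : Prop := perm_eq (edges_of s) (enum E).

(* Integer array 0 holds the numbers of vertices and edges and the position of
   e in the list s; integer arrays 1 and 2 hold the endpoints of the edges, real
   arrays 0 and 1 the bounds of the intervals.  All other cells are 0. *)
Definition input s (l h : {set 'I_n} -> R) (e : {set 'I_n}) : state R :=
  State
    (fun x => nth 0%N (nth [::]
       [:: [:: n; size s; index e (edges_of s)];
           [seq val p.1 | p <- s];
           [seq val p.2 | p <- s]] x))
    (fun x => nth 0 (nth [::] [:: map l (edges_of s); map h (edges_of s)] x)).

Definition output (st : state R) : R * R := (rmem st 2 0, rmem st 2 1).

End Encoding.

(* Main.v *)
Require Import Defs.
From HB Require Import structures.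
From mathcomp Require Import all_boot all_order all_algebra.
From mathcomp Require Import all_classical all_reals.
From mathcomp Require Import ring zify.

(** Attach a potential g x to every vertex, initially 0, and give the edge f
    the reduced weight w f - sum_{x in f} g x (with w e read as 0).  If v is an
    end of a single remaining edge vp, different from e, then deleting vp and
    raising g p to max(g p, w vp - g v) changes the maximum weights of the
    matchings with e and without e by the same amount, so the threshold is
    preserved.  Once only e = ab is left, the threshold is g a + g b.

    Since the new potential is increasing in w vp and decreasing in g v, the
    extreme potentials over all realizations obey the recursion
    gm p := max(gm p, l vp - gM v), gM p := max(gM p, h vp - gm v), and the
    extreme values are attained simultaneously at all vertices.

    In linear time: store for each vertex its degree and the sum of the
    positions of its remaining edges.  The latter is the position of the only
    edge at a vertex of degree 1, so no adjacency lists are needed.  Scan the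
    vertices in increasing order and, whenever an edge vp is deleted, proceed
    to p before resuming the scan.  A forest with an edge other than e has a
    pendant edge other than e, at an end of a longest path, hence the scan ends
    with e alone. *)

Import Order.TTheory GRing.Theory Num.Theory.

Local Open Scope ring_scope.

(** * Deleting a pendant edge *)

Section LeafReduction.
Set Implicit Arguments.
Unset Strict Implicit.
Variables (R : realType) (V : finType).
Implicit Types (E F M : {set {set V}}) (e f q : {set V}) (c w l h : {set V} -> R).
Implicit Types (g : V -> R) (v p x : V).

(** A relation rather than a [\big[Num.max/0]]: reduced weights may be negative, so a default value
    0 could exceed the true maximum. *)
Definition opt F e (b : bool) c (m : R) : Prop :=
  (exists M, [/\ matching F M, (e \in M) = b & weight c M = m]) /\
  (forall M, matching F M -> (e \in M) = b -> weight c M <= m).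

Definition gap F e c (d : R) : Prop :=
  exists m0 m1, [/\ opt F e false c m0, opt F e true c m1 & d = m0 - m1].

Definition reduced w g e f : R :=
  (if f == e then 0 else w f) - \sum_(x in f) g x.

Lemma matching_incident_sum F M p (d : R) : matching F M ->
  \sum_(f in M) (if p \in f then d else 0) = if p \in finset.cover M then d else 0.
Proof.
case/andP=> _ /finset.trivIsetP tM; rewrite -big_mkcondr /=.
case: ifPn => [/finset.bigcupP[f0 f0M pf0]|pM].
  rewrite (big_pred1 f0) // => f /=; apply/andP/eqP => [[fM pf]|-> //].
  apply/eqP/negPn/negP => /(tM _ _ fM f0M)/pred0P/(_ p) /=.
  by rewrite pf pf0.
rewrite big_pred0 // => f; apply/negP => /andP[fM pf].
by case/negP: pM; apply/finset.bigcupP; exists f.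
Qed.

(* A maximum weight matching may be assumed to use the pendant edge q = vp as
   soon as c q > 0, unless it covers p otherwise; charging max(0, c q) to p
   makes q superfluous. *)
Lemma opt_leaf F e b c c' q v p m : v != p -> q = [set v; p]%SET -> q \in F ->
  q != e -> (forall f, f \in F -> v \in f -> f = q) ->
  (forall f, f \in (F :\ q)%SET ->
     c' f = c f - (if p \in f then Num.max 0 (c q) else 0)) ->
  opt F e b c m -> opt (F :\ q)%SET e b c' (m - Num.max 0 (c q)).
Proof.
move=> vp qE qF qe vq; set d := Num.max 0 (c q) => c'E [[M [mM eM wM]] ub].
have d0 : 0 <= d by rewrite /d le_max lexx.
have dq : c q <= d by rewrite /d le_max lexx orbT.
have wE M1 : matching (F :\ q)%SET M1 ->
    weight c' M1 = weight c M1 - if p \in finset.cover M1 then d else 0.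
  move=> mM1; rewrite -(matching_incident_sum p d mM1) /weight -sumrB.
  apply: eq_bigr => f fM; apply: c'E.
  by case/andP: mM1 => /fintype.subsetP/(_ _ fM).
have ub' M1 : matching (F :\ q)%SET M1 -> (e \in M1) = b -> weight c' M1 <= m - d.
  move=> mM1 eM1; rewrite wE //; case/andP: (mM1) => sM1 /finset.trivIsetP tM1.
  have mM1F : matching F M1.
    apply/andP; split; last exact/finset.trivIsetP.
    exact: fintype.subset_trans sM1 (subD1set _ _).
  (* If [M1] covers [p] it already pays the charge [d]. Otherwise [q] can be added to it when
     [c q > 0], because [v] lies in no other edge. *)
  case: ifPn => pM1; first by rewrite lerD2r ub.
  rewrite subr0; case: (leP (c q) 0) => cq.
    have -> : d = 0 by rewrite /d; apply/max_idPl.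
    by rewrite subr0 ub.
  have -> : d = c q by rewrite /d; apply/max_idPr/ltW.
  have qM1 : q \notin M1.
    by apply/negP => /(fintype.subsetP sM1); rewrite !inE eqxx.
  rewrite lerBrDl -(big_setU1 _ qM1) /=; apply: ub.
    apply/andP; split.
      apply/fintype.subsetP => f; rewrite !inE => /orP[/eqP -> //|/(fintype.subsetP sM1)].
      by rewrite !inE => /andP[].
    have dj f : f \in M1 -> [disjoint q & f].
      move=> fM1; rewrite qE disjoint_sym; apply/pred0P => x /=; rewrite !inE.
      apply/negP => /andP[xf /orP[] /eqP xE]; rewrite {}xE in xf.
        have fF : f \in F by move/(fintype.subsetP sM1): fM1; rewrite !inE => /andP[].
        by move: qM1; rewrite -(vq _ fF xf) fM1.
      by case/negP: pM1; apply/finset.bigcupP; exists f.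
    apply/finset.trivIsetP => A B; rewrite !inE.
    move=> /orP[/eqP ->|AM] /orP[/eqP ->|BM]; rewrite ?eqxx // => AB.
    - exact: dj.
    - by rewrite disjoint_sym dj.
    - exact: tM1.
  by rewrite !inE eq_sym (negbTE qe).
(* An optimal [M] stays optimal without [q]: if [q] was in [M], the loss [c q] is at most [d] and
   [p] is no longer covered; if not, the charge at [p] is at most [d]. *)
split=> //; exists (M :\ q)%SET.
have mM' : matching (F :\ q)%SET (M :\ q)%SET.
  case/andP: mM => sM tM; apply/andP; split; first exact: finset.setSD.
  by apply: trivIsetS tM; exact: subD1set.
have eM' : (e \in (M :\ q)%SET) = b by rewrite !inE eq_sym qe.
split=> //; apply/eqP; rewrite eq_le ub' //= wE // -wM.
case/andP: mM => sM /finset.trivIsetP tM.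
case: (boolP (q \in M)) => qM; last first.
  have -> : (M :\ q)%SET = M.
    by apply/finset.setP => f; rewrite !inE; case: eqP => // ->; rewrite (negbTE qM).
  by rewrite lerD2l lerN2; case: ifP.
rewrite {1}/weight (big_setD1 q) //=.
case: ifPn => [/finset.bigcupP[f]|_]; last by rewrite subr0 addrAC gerDr subr_le0.
rewrite !inE => /andP[fq fM] pf.
by move/pred0P: (tM _ _ fM qM fq) => /(_ p) /=; rewrite pf qE !inE eqxx orbT.
Qed.

(** Both optima drop by the same amount, which cancels in their difference. The value [g' v] is left
    free since no remaining edge contains [v]. *)
Lemma gap_leaf F e q v p w g g' d : v != p -> q = [set v; p]%SET -> q \in F ->
  q != e -> (forall f, f \in F -> v \in f -> f = q) ->
  (forall x, x != v ->
     g' x = if x == p then Num.max (g p) (w q - g v) else g x) ->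
  gap F e (reduced w g e) d -> gap (F :\ q)%SET e (reduced w g' e) d.
Proof.
move=> vp qE qF qe vq g'E [m0 [m1 [o0 o1 ->]]].
set dl := Num.max 0 (reduced w g e q).
(* The reduced weight of [q] is [w q - g v - g p], so the rise of the potential at [p] is exactly
   the charge of [opt_leaf]. *)
have dlE : Num.max (g p) (w q - g v) = g p + dl.
  rewrite /dl /reduced (negbTE qe) qE big_setU1 ?inE //= big_set1.
  by rewrite addr_maxr addr0; congr Num.max; ring.
have cE f : f \in (F :\ q)%SET ->
    reduced w g' e f = reduced w g e f - (if p \in f then dl else 0).
  rewrite !inE => /andP[fq fF]; rewrite /reduced -addrA -opprD; congr (_ - _).
  transitivity (\sum_(x in f) (g x + if x == p then dl else 0)).
    apply: eq_bigr => x xf; rewrite g'E; last first.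
      by apply: contraNneq fq => xv; rewrite xv in xf; rewrite (vq _ fF xf).
    by case: eqP => [->|]; rewrite ?addr0.
  rewrite big_split /=; congr (_ + _); rewrite -big_mkcondr /=.
  case: ifPn => pf.
    by rewrite (big_pred1 p) // => x /=; rewrite andbC; case: eqP => // ->.
  by rewrite big_pred0 // => x; rewrite andbC; case: eqP => // ->; rewrite (negbTE pf).
exists (m0 - dl), (m1 - dl); split; try exact: (opt_leaf vp qE qF qe vq cE).
by ring.
Qed.

Lemma matching_set0 E : matching E finset.set0.
Proof.
by apply/andP; split; [exact: finset.sub0set|apply/finset.trivIsetP => A B; rewrite inE].
Qed.

Lemma matching_set1 E e : e \in E -> matching E [set e]%SET.
Proof.
move=> eE; apply/andP; split; first by rewrite finset.sub1set.
by apply/finset.trivIsetP => A B; rewrite !inE => /eqP -> /eqP ->; rewrite eqxx.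
Qed.

(** The witness [M0] of weight 0 makes the default value an attained one. Two weights occur because
    [max_without] uses [w] itself, while [reduced] reads [w e] as 0. *)
Lemma opt_bigmax E e b c0 c M0 : matching E M0 -> (e \in M0) = b ->
  weight c0 M0 = 0 ->
  (forall M, matching E M -> (e \in M) = b -> weight c0 M = weight c M) ->
  opt E e b c
    (\big[Num.max/0]_(M : {set {set V}} | matching E M && ((e \in M) == b))
       weight c0 M).
Proof.
move=> mM0 eM0 w0 cE; split.
  apply: (big_ind (fun y =>
    exists M, [/\ matching E M, (e \in M) = b & weight c M = y])).
  - by exists M0; rewrite -cE.
  - by move=> x y [Mx Hx] [My Hy]; case: (leP x y) => _; [exists My|exists Mx].
  - by move=> M /andP[mM /eqP eM]; exists M; rewrite cE.
move=> M mM eM; rewrite -cE //.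
apply: (le_bigmax_cond 0 (P := fun M => matching E M && ((e \in M) == b)) (weight c0)).
by rewrite mM eM eqxx.
Qed.

Lemma gap_threshold E e w : e \in E ->
  gap E e (reduced w (fun=> 0) e) (threshold E e w).
Proof.
move=> eE; exists (max_without E e w), (max_with E e w); split => //.
  rewrite /max_without (eq_bigl (fun M => matching E M && ((e \in M) == false))).
    apply: (@opt_bigmax _ _ _ _ _ finset.set0); rewrite ?matching_set0 ?inE //.
      by rewrite /weight big_set0.
    move=> M mM eM; apply: eq_bigr => f fM; rewrite /reduced big1 // subr0.
    by case: eqP fM => // ->; rewrite eM.
  by move=> M; rewrite eqbF_neg.
rewrite /max_with (eq_bigl (fun M => matching E M && ((e \in M) == true))).
  apply: (@opt_bigmax _ _ _ _ _ [set e]%SET); rewrite ?matching_set1 ?inE ?eqxx //.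
    by rewrite /weight big_set1 eqxx.
  by move=> M mM eM; apply: eq_bigr => f fM; rewrite /reduced big1 // subr0.
by move=> M; rewrite eqb_id.
Qed.

Lemma gap_set1 e c d : gap [set e]%SET e c d -> d = - c e.
Proof.
move=> [m0 [m1 [[[M0 [/andP[s0 _] e0 <-]] _] [[M1 [/andP[s1 _] e1 <-]] _] ->]]].
have -> : M0 = finset.set0.
  by move: s0; rewrite finset.subset1 => /orP[] /eqP // M0E; rewrite M0E !inE eqxx in e0.
have -> : M1 = [set e]%SET.
  by move: s1; rewrite finset.subset1 => /orP[] /eqP // M1E; rewrite M1E !inE in e1.
by rewrite /weight big_set0 big_set1 sub0r.
Qed.

(* The potentials of distinct vertices depend on disjoint sets of removed
   edges, so the choice sigma between gm and gM is independent at every vertex;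
   the weights of the remaining edges are still free, whence w'. *)
Definition envelope E F e l h (gm gM : V -> R) : Prop :=
  (forall w, realizations E e l h w -> exists g,
     (forall x, gm x <= g x <= gM x) /\
     gap F e (reduced w g e) (threshold E e w)) /\
  (forall sigma : V -> bool, exists w, realizations E e l h w /\
     forall w', (forall f, f \in (E :\: F)%SET -> w' f = w f) ->
     gap F e (reduced w' (fun x => if sigma x then gM x else gm x) e)
       (threshold E e w')).

Lemma envelope_init E e l h : e \in E ->
  (forall f, f \in E -> l f <= h f) ->
  envelope E E e l h (fun=> 0) (fun=> 0).
Proof.
move=> eE lh; split => [w _|sigma].
  by exists (fun=> 0); split => [x|]; [rewrite lexx|exact: gap_threshold].
exists l; split.
  by move=> f; rewrite !inE => /andP[_ fE] /=; rewrite lexx lh.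
move=> w' _; rewrite (_ : (fun x => _) = fun=> 0); first exact: gap_threshold.
by apply/funext => x; case: ifP.
Qed.

Lemma envelope_leaf E F e l h gm gM gm' gM' q v p :
  F \subset E -> (forall f, f \in E -> l f <= h f) ->
  v != p -> q = [set v; p]%SET -> q \in F ->
  q != e -> (forall f, f \in F -> v \in f -> f = q) ->
  (forall x, gm' x = if x == p then Num.max (gm p) (l q - gM v) else gm x) ->
  (forall x, gM' x = if x == p then Num.max (gM p) (h q - gm v) else gM x) ->
  envelope E F e l h gm gM -> envelope E (F :\ q)%SET e l h gm' gM'.
Proof.
move=> FE lh vp qE qF qe vq gm'E gM'E [inv1 inv2].
have qEe : q \in (E :\ e)%SET by rewrite !inE qe (fintype.subsetP FE).
split => [w rw|sigma].
  have [g [gb gg]] := inv1 w rw.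
  exists (fun x => if x == p then Num.max (g p) (w q - g v) else g x); split.
    move=> x; rewrite gm'E gM'E; case: (x == p) => //.
    have /andP[gp1 gp2] := gb p; have /andP[gv1 gv2] := gb v.
    have /andP[w1 w2] : l q <= w q <= h q by exact: rw.
    by rewrite !ge_max !le_max gp1 gp2 !lerB ?orbT.
  exact: (gap_leaf vp qE qF qe vq _ gg).
(* The potential of [v] enters that of [p] with a minus sign, so the choice at [v] is opposite to
   the one at [p]. The weight of [q] may still be set to [t], as [w] is binding only outside [F]. *)
have [w [rw Hw]] := inv2 (fun x => if x == v then ~~ sigma p else sigma x).
set t := if sigma p then h q else l q.
exists (fun f => if f == q then t else w f); split.
  move=> f fE /=; case: eqP => [->|_]; last exact: rw.
  by rewrite /t; case: ifP => _; rewrite lexx lh // (fintype.subsetP FE).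
move=> w' w'E.
have w'q : w' q = t by rewrite w'E ?eqxx // !inE eqxx /= (fintype.subsetP FE).
have agr f : f \in (E :\: F)%SET -> w' f = w f.
  rewrite !inE => /andP[fF fE]; rewrite w'E.
    by case: eqP => // fq; rewrite fq qF in fF.
  by rewrite !inE (negbTE fF) andbF fE.
apply: (gap_leaf vp qE qF qe vq _ (Hw w' agr)) => x xv.
rewrite eqxx w'q gm'E gM'E [p == v]eq_sym (negbTE vp) (negbTE xv) /t.
by case: eqP => [->|_] //; case: (sigma p).
Qed.

Lemma inf_eq_min (A : set R) (m : R) : A m -> (forall y, A y -> m <= y) -> inf A = m.
Proof.
move=> Am lb; apply/eqP; rewrite eq_le ge_inf //=; last by exists m.
by apply: lb_le_inf => //; exists m.
Qed.

Lemma sup_eq_max (A : set R) (m : R) : A m -> (forall y, A y -> y <= m) -> sup A = m.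
Proof.
move=> Am ub; apply/eqP; rewrite eq_le ub_le_sup //=; last by exists m.
by rewrite andbT; apply: ge_sup => //; exists m.
Qed.

Lemma envelope_set1 E e l h gm gM a b : a != b -> e = [set a; b]%SET ->
  envelope E [set e]%SET e l h gm gM ->
  inf (thresholds E e l h) = gm a + gm b /\
  sup (thresholds E e l h) = gM a + gM b.
Proof.
move=> ab eE [inv1 inv2].
have redE w g : - reduced w g e e = g a + g b.
  by rewrite /reduced eqxx sub0r opprK eE big_setU1 ?inE //= big_set1.
split.
  apply: inf_eq_min.
    (* A constant [sigma] makes both ends of [e] extreme in the same realization. *)
    have [w [rw Hw]] := inv2 (fun=> false); exists w => //.
    by rewrite (gap_set1 (Hw w (fun _ _ => erefl))) redE.
  move=> _ [w rw <-]; have [g [gb /gap_set1 ->]] := inv1 w rw.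
  by rewrite redE lerD //; [case/andP: (gb a)|case/andP: (gb b)].
apply: sup_eq_max.
  have [w [rw Hw]] := inv2 (fun=> true); exists w => //.
  by rewrite (gap_set1 (Hw w (fun _ _ => erefl))) redE.
move=> _ [w rw <-]; have [g [gb /gap_set1 ->]] := inv1 w rw.
by rewrite redE lerD //; [case/andP: (gb a)|case/andP: (gb b)].
Qed.

End LeafReduction.

(** * Pendant edges of a forest *)

Section PendantEdges.
Set Implicit Arguments.
Unset Strict Implicit.
Local Open Scope nat_scope.
Variable V : finType.
Implicit Types (E F : {set {set V}}) (x y v p : V) (c : seq V).

Lemma simple_edge E (f : {set V}) x : simple_graph E -> f \in E -> x \in f ->
  exists2 y, x != y & f = [set x; y]%SET.
Proof.
move=> sE fE xf; have /cards2P[a [b [ab fE']]] : #|f| == 2 by rewrite sE.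
move: xf; rewrite fE' !inE => /orP[] /eqP ->; first by exists b.
by exists a; rewrite 1?eq_sym // finset.setUC.
Qed.

Lemma acyclicS E F : F \subset E -> acyclic E -> acyclic F.
Proof.
move=> FE aE c /andP[cc uc]; apply: aE; rewrite /ucycle uc andbT.
by apply: sub_cycle cc => x y; rewrite /adj; exact: (fintype.subsetP FE).
Qed.

(** A second edge at [x] would lead back to a later vertex of the path and close a cycle on at least
    three vertices. *)
Lemma inextensible_end F x y c : simple_graph F -> acyclic F ->
  uniq (x :: y :: c) -> path (adj F) x (y :: c) ->
  (forall z, adj F z x -> z \in [:: x, y & c]) ->
  forall f, f \in F -> x \in f -> f = [set x; y]%SET.
Proof.
move=> sF aF uc pc ext f fF xf; have [z xz fE] := simple_edge sF fF xf.
have zx : adj F z x by rewrite /adj finset.setUC -fE.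
have := ext z zx; rewrite !inE eq_sym (negbTE xz) /= => /orP[/eqP <- //|zc].
case/splitPr: zc uc pc {ext} => c1 c2 uc pc.
suff /aF : ucycle (adj F) (x :: y :: rcons c1 z) by rewrite /= size_rcons.
apply/andP; split.
  move: pc; rewrite -cat_cons -cat_rcons cat_path => /andP[pc _].
  rewrite /cycle -rcons_cons rcons_path last_rcons zx andbT.
  by rewrite rcons_cons.
move: uc; rewrite -!cat_cons -cat_rcons cat_uniq => /andP[].
by rewrite !rcons_cons.
Qed.

(* Both ends of a longest path are pendant, and they lie on distinct edges
   unless the path consists of a single edge. *)
Lemma pendant_edge F e f : simple_graph F -> acyclic F -> f \in F -> f != e ->
  exists v p, [/\ v != p, [set v; p]%SET \in F, [set v; p]%SET != e &
    forall f', f' \in F -> v \in f' -> f' = [set v; p]%SET].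
Proof.
move=> sF aF fF fe.
have [x xf] : exists x, x \in f by apply/set0Pn; rewrite -card_gt0 sF.
have [y xy fE] := simple_edge sF fF xf.
have symF : symmetric (adj F) by move=> a b; rewrite /adj finset.setUC.
pose P k := [exists t : k.-tuple V, uniq t && sorted (adj F) t].
have P2 : P 2.
  by apply/existsP; exists [tuple x; y]; rewrite /= inE xy /adj -fE fF.
have Pmax k : P k -> k <= #|V|.
  by move=> /existsP[t /andP[/card_uniqP tk _]]; rewrite -{1}(size_tuple t) -tk max_card.
have exP : exists k, P k by exists 2.
case: (ex_maxnP exP Pmax) => k Pk kmax.
have Pc c : uniq c -> sorted (adj F) c -> P (size c).
  by move=> uc pc; apply/existsP; exists (in_tuple c); rewrite uc pc.
have pend a b c : size [:: a, b & c] = k -> uniq [:: a, b & c] ->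
    sorted (adj F) [:: a, b & c] ->
    [/\ a != b, [set a; b]%SET \in F
      & forall f', f' \in F -> a \in f' -> f' = [set a; b]%SET].
  move=> sc uc pc; split.
  - by move: uc; rewrite /= inE negb_or -andbA => /andP[].
  - by move: pc => /= /andP[].
  apply: (inextensible_end sF aF uc pc) => z za.
  apply/negPn/negP => zc.
  have : P (size [:: z, a, b & c]).
    by apply: Pc; [rewrite cons_uniq zc uc|rewrite /= za; exact: pc].
  by move/kmax; rewrite -sc ltnn.
case/existsP: Pk => -[c /= /eqP ck] /andP[uc pc].
have k2 := kmax 2 P2.
case: c ck uc pc => [|a [|b [|d c]]] ck uc pc; try by rewrite -ck in k2.
  (* No path has three vertices, so [f] itself is pendant. *)
  have [|||_ _ xP] := pend x y [::]; rewrite /= ?inE ?xy ?/adj -?fE ?fF //.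
  by exists x, y; rewrite -fE xy; split=> // f'; rewrite fE; exact: xP.
have [ab abF aP] := pend _ _ _ ck uc pc.
have [abe|abe] := eqVneq [set a; b]%SET e; last by exists a, b.
(* The first edge of the path is [e]; the reversed path yields the last one. Were that [e] too, [a]
   would occur twice on the path. *)
move: uc pc ck; rewrite -(revK [:: a, b, d & c]) rev_uniq rev_sorted size_rev.
rewrite (eq_sorted (e' := adj F)); last by move=> u v; rewrite symF.
set r := rev _; have: last a r = a by rewrite /r rev_cons last_rcons.
have: size r = (size c).+3 by rewrite /r size_rev.
case: r => [//|a' [//|b' [//|d' r]]] _ lr uc pc ck.
have [ab' abF' aP'] := pend _ _ _ ck uc pc.
exists a', b'; split => //; apply/eqP => abe'.
have : a \in [set a'; b']%SET by rewrite abe' -abe !inE eqxx.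
have ar : a \in d' :: r by rewrite -[X in X \in _]lr /= mem_last.
rewrite !inE => /orP[] /eqP aE; rewrite aE in ar; move: uc.
  by rewrite /= !inE in ar *; rewrite ar orbT.
by rewrite /= !inE in ar *; rewrite ar /= andbF.
Qed.

End PendantEdges.

(** * Verification of loop-free programs and loops *)

Section Runs.
Set Implicit Arguments.
Unset Strict Implicit.
Local Open Scope nat_scope.
Variables (R : realType) (B : nat).
Implicit Types (c : cmd) (s : state R) (Q : state R -> Prop).

Definition runs c (T : nat) Q s : Prop :=
  exists t s', [/\ exec B c s t s', t <= T & Q s'].

(* The cost 0 of a loop is a junk value: wp below excludes loops. *)
Fixpoint wcost c : nat :=
  match c with
  | Skip => 1
  | IAssign _ i a => (icost i + icost a).+1
  | RAssign _ i a => (icost i + rcost a).+1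
  | Seq c1 c2 => wcost c1 + wcost c2
  | If b c1 c2 => bcost b + maxn (wcost c1) (wcost c2)
  | While _ _ => 0
  end.

Fixpoint wp c Q s : Prop :=
  match c with
  | Skip => Q s
  | IAssign x i a => ieval s a <= B /\
      Q (State (upd (imem s) x (ieval s i) (ieval s a)) (rmem s))
  | RAssign x i a => Q (State (imem s) (upd (rmem s) x (ieval s i) (reval s a)))
  | Seq c1 c2 => wp c1 (wp c2 Q) s
  | If b c1 c2 => if beval s b then wp c1 Q s else wp c2 Q s
  | While _ _ => False
  end.

Lemma wp_runs c Q s : wp c Q s -> runs c (wcost c) Q s.
Proof.
elim: c Q s => [|x i a|x i a|c1 IH1 c2 IH2|b c1 IH1 c2 IH2|//] Q s /=.
- by exists 1, s; split=> //; exact: ESkip.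
- by case=> aB Qs; eexists _, _; split; [exact: EIAssign| |exact: Qs].
- by move=> Qs; eexists _, _; split; [exact: ERAssign| |exact: Qs].
- move=> /IH1[t1 [s1 [e1 le1 /IH2[t2 [s2 [e2 le2 Q2]]]]]].
  by exists (t1 + t2), s2; split=> //; [exact: ESeq e1 e2|exact: leq_add].
- move=> H; have [t [s' [ex le Q']]] : runs (if beval s b then c1 else c2)
      (maxn (wcost c1) (wcost c2)) Q s.
    case: (beval s b) H => [/IH1|/IH2] [t [s' [ex le Q']]];
      exists t, s'; split=> //; by rewrite leq_max le ?orbT.
  by exists (bcost b + t), s'; split=> //; [exact: EIf|rewrite leq_add2l].
Qed.

Lemma runs_seq c1 c2 T1 T2 Q1 Q s : runs c1 T1 Q1 s ->
  (forall s', Q1 s' -> runs c2 T2 Q s') -> runs (Seq c1 c2) (T1 + T2) Q s.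
Proof.
move=> [t1 [s1 [e1 le1 q1]]] /(_ _ q1)[t2 [s2 [e2 le2 q2]]].
by exists (t1 + t2), s2; split=> //; [exact: ESeq e1 e2|exact: leq_add].
Qed.

(** The index of the invariant drops at each iteration, so there are at most [k] of them; the last
    summand pays for the failing test. *)
Lemma runs_while b c K (I : nat -> state R -> Prop) k s :
  (forall k s, I k s -> beval s b ->
     runs c K (fun s' => exists2 k', k' < k & I k' s') s) ->
  I k s ->
  runs (While b c) ((bcost b + K) * k + bcost b)
    (fun s' => (exists k', I k' s') /\ ~~ beval s' b) s.
Proof.
move=> step; elim/ltn_ind: k s => k IH s Is.
have [bs|bs] := boolP (beval s b); last first.
  exists (bcost b), s; split; [exact: EWhileFalse|exact: leq_addl|].
  by split=> //; exists k.
have [t1 [s1 [e1 le1 [k' k'k Ik']]]] := step _ _ Is bs.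
have [t2 [s2 [e2 le2 Q2]]] := IH _ k'k _ Ik'.
exists (bcost b + t1 + t2), s2; split=> //; first exact: EWhileTrue e1 e2.
nia.
Qed.

End Runs.

(** * The program *)

Section Program.
Local Notation "c1 ;; c2" := (Seq c1 c2) (at level 60, right associativity).

(* Integer array 3 holds the degrees in the current forest, array 4 the sum
   of the positions of the incident edges, so that the only edge at a vertex
   of degree 1 can be read off; array 6 holds the scalar variables.  Real
   arrays 3 and 4 hold the lower and upper potentials. *)
Definition scalar k := IRead 6 (IConst k).
Local Notation jvar := (scalar 0).
Local Notation ivar := (scalar 1).
Local Notation vvar := (scalar 2).
Local Notation qvar := (scalar 3).
Local Notation pvar := (scalar 4).

Definition add_endpoint (u : iexp) : cmd :=
  IAssign 3 u (IAdd (IRead 3 u) (IConst 1)) ;;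
  IAssign 4 u (IAdd (IRead 4 u) jvar).

Definition add_edge : cmd :=
  add_endpoint (IRead 1 jvar) ;; add_endpoint (IRead 2 jvar) ;;
  IAssign 6 (IConst 0) (IAdd jvar (IConst 1)).

Definition edges_left : bexp := BNot (ILe (IRead 0 (IConst 1)) jvar).

Definition ieq (a1 a2 : iexp) : bexp := BAnd (ILe a1 a2) (ILe a2 a1).

Definition is_pendant : bexp :=
  BAnd (ieq (IRead 3 vvar) (IConst 1))
       (BNot (ieq (IRead 4 vvar) (IRead 0 (IConst 2)))).

Definition del_endpoint (u : iexp) : cmd :=
  IAssign 3 u (ISub (IRead 3 u) (IConst 1)) ;;
  IAssign 4 u (ISub (IRead 4 u) qvar).

Definition raise (x bnd y : nat) : cmd :=
  If (RLe (RRead x pvar) (RSub (RRead bnd qvar) (RRead y vvar)))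
     (RAssign x pvar (RSub (RRead bnd qvar) (RRead y vvar))) Skip.

(** The sum of both ends minus [v] is the other end [p], in whichever order they are listed. The
    second [raise] is unaffected by the first, which writes at [p], whereas array 3 is then read at
    [v]. *)
Definition remove_pendant : cmd :=
  IAssign 6 (IConst 3) (IRead 4 vvar) ;;
  IAssign 6 (IConst 4) (ISub (IAdd (IRead 1 qvar) (IRead 2 qvar)) vvar) ;;
  raise 3 0 4 ;; raise 4 1 3 ;;
  del_endpoint vvar ;; del_endpoint pvar ;;
  IAssign 6 (IConst 2) pvar.

Definition next_vertex : cmd :=
  IAssign 6 (IConst 1) (IAdd ivar (IConst 1)) ;; IAssign 6 (IConst 2) ivar.

Definition vertices_left : bexp := BNot (ILe (IRead 0 (IConst 0)) ivar).

Definition prune : cmd := If is_pendant remove_pendant next_vertex.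

Definition write_output (k x : nat) : cmd :=
  RAssign 2 (IConst k) (RAdd (RRead x (IRead 1 (IRead 0 (IConst 2))))
                             (RRead x (IRead 2 (IRead 0 (IConst 2))))).

Definition threshold_bounds : cmd :=
  While edges_left add_edge ;; While vertices_left prune ;;
  write_output 0 3 ;; write_output 1 4.

End Program.

(** * Sums over the edges at a vertex *)

Section Incidence.
Set Implicit Arguments.
Unset Strict Implicit.
Local Open Scope nat_scope.
Variable V : finType.
Implicit Types (F : {set {set V}}) (q : {set V}) (x : V) (G : {set V} -> nat).

(** With [G] constantly 1 this is the degree kept in array 3; with the position of an edge as [G] it
    is the content of array 4. *)
Definition incident F x G : nat := \sum_(f in F | x \in f) G f.

Lemma incidentU1 F q x G : q \notin F ->
  incident (q |: F)%SET x G = incident F x G + (if x \in q then G q else 0).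
Proof.
move=> qF; by rewrite /incident !big_mkcondr /= big_setU1 //= addnC.
Qed.

Lemma incidentD1 F q x G : q \in F ->
  incident F x G = incident (F :\ q)%SET x G + (if x \in q then G q else 0).
Proof.
by move=> qF; rewrite -incidentU1 ?finset.setD1K // !inE eqxx.
Qed.

Lemma incident_unique F q x G : q \in F -> x \in q ->
  (forall f, f \in F -> x \in f -> f = q) -> incident F x G = G q.
Proof.
move=> qF xq uq; rewrite /incident (big_pred1 q) // => f /=.
by apply/andP/eqP => [[]|->] //; exact: uq.
Qed.

Lemma incident1_unique F x : incident F x (fun=> 1) = 1 ->
  exists q, [/\ q \in F, x \in q & forall f, f \in F -> x \in f -> f = q].
Proof.
rewrite /incident sum1dep_card => /eqP/cards1P[q qE].
have /andP[qF xq] : (q \in F) && (x \in q).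
  by have := set11 q; rewrite -qE inE.
exists q; split=> // f fF xf; apply/set1P.
by rewrite -qE inE fF.
Qed.

Lemma incident_le F x G k : (forall f, f \in F -> G f <= k) ->
  incident F x G <= #|F| * k.
Proof.
move=> Gk; rewrite -sum_nat_const /incident big_mkcondr /=.
by apply: leq_sum => f fF; case: ifP => // _; exact: Gk.
Qed.

End Incidence.

(** * Correctness and running time *)

Section Correctness.
Set Implicit Arguments.
Unset Strict Implicit.
Variables (R : realType) (n : nat) (E : {set {set 'I_n}}).
Variables (l h : {set 'I_n} -> R) (e : {set 'I_n}) (s : seq ('I_n * 'I_n)).
Hypotheses (sE : simple_graph E) (aE : acyclic E).
Hypotheses (lh : forall f, f \in E -> l f <= h f) (eE : e \in E).
Hypothesis (Es : edge_list E s).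
Implicit Types (st : state R) (F : {set {set 'I_n}}) (f q : {set 'I_n}).
Implicit Types (x v p : 'I_n) (gm gM : 'I_n -> R).

Local Notation es := (edges_of s).
Local Notation pos f := (index f es).
Local Notation inp := (input s l h e).
Local Notation B := ((n + #|E|) ^ 2)%N.

(** * Decoding the input and bounding the stored integers *)

Lemma mem_edges f : (f \in es) = (f \in E).
Proof. by rewrite (perm_mem Es) mem_enum. Qed.

Lemma uniq_edges : uniq es.
Proof. by rewrite (perm_uniq Es) enum_uniq. Qed.

Lemma size_edges : size es = #|E|.
Proof. by rewrite (perm_size Es) cardE. Qed.

Lemma pos_lt f : f \in E -> (pos f < #|E|)%N.
Proof. by rewrite -size_edges index_mem mem_edges. Qed.

Lemma input_endpoints q : q \in E -> exists u w : 'I_n,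
  [/\ imem inp 1 (pos q) = u, imem inp 2 (pos q) = w, u != w
    & q = [set u; w]%SET].
Proof.
move=> qE; have qs : (pos q < size s)%N.
  rewrite -(size_map (fun p : 'I_n * 'I_n => [set p.1; p.2]%SET) s).
  by rewrite index_mem mem_edges.
have [u0 w0] : 'I_n * 'I_n by case: (s) qs => // p *; exact: p.
have qnth : q = [set (nth (u0, w0) s (pos q)).1; (nth (u0, w0) s (pos q)).2]%SET.
  rewrite -(nth_map _ finset.set0 (fun p : 'I_n * 'I_n => [set p.1; p.2]%SET)) //.
  by rewrite nth_index // mem_edges.
exists (nth (u0, w0) s (pos q)).1, (nth (u0, w0) s (pos q)).2; split=> //=.
- by rewrite (nth_map (u0, w0)).
- by rewrite (nth_map (u0, w0)).
- by apply/eqP => uw; have := sE qE; rewrite {1}qnth uw finset.setUid cards1.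
Qed.

Lemma input_bounds q : q \in E ->
  rmem inp 0 (pos q) = l q /\ rmem inp 1 (pos q) = h q.
Proof.
by move=> qE; rewrite /= !(nth_map finset.set0) ?nth_index ?index_mem ?mem_edges.
Qed.

Lemma leq_sqr a b : (a <= b)%N -> (a <= b ^ 2)%N.
Proof. by move=> ab; rewrite -mulnn; nia. Qed.

Lemma incident1_bound F x : F \subset E -> (incident F x (fun=> 1) <= B)%N.
Proof.
move=> FE; apply: leq_trans (incident_le x (k := 1) _) _ => //.
by rewrite muln1; exact/leq_sqr/(leq_trans (subset_leq_card FE))/leq_addl.
Qed.

(** The source of the exponent 2 in [B]: at most [#|E|] positions are added, each below [#|E|]. *)
Lemma incident_pos_bound F x : F \subset E ->
  (incident F x (fun f => pos f) <= B)%N.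
Proof.
move=> FE; apply: leq_trans (incident_le x (k := #|E|) _) _ => [f fF|].
  by apply/ltnW/pos_lt; exact: (fintype.subsetP FE).
have /leq_mul/(_ (leqnn #|E|))/leq_trans -> // := subset_leq_card FE.
by rewrite -mulnn leq_mul // leq_addl.
Qed.

(** * The loop that tabulates degrees and position sums *)

Definition loaded st : Prop :=
  [/\ imem st 0 = imem inp 0, imem st 1 = imem inp 1, imem st 2 = imem inp 2,
      rmem st 0 = rmem inp 0 & rmem st 1 = rmem inp 1].

Definition tabulated F st : Prop := forall x,
  imem st 3 x = incident F x (fun=> 1%N) /\
  imem st 4 x = incident F x (fun f => pos f).

Definition loading (k : nat) st : Prop := exists j, [/\ (j + k)%N = #|E|,
  loaded st, imem st 6 0 = j, tabulated [set f in take j es]%SET st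
  & [/\ imem st 6 1 = 0%N, imem st 6 2 = 0%N, rmem st 3 =1 (fun=> 0)
    & rmem st 4 =1 (fun=> 0)]].

Lemma input_loading : loading #|E| inp.
Proof.
exists 0%N; split=> //= [x|]; last by split=> // x; rewrite /= nth_nil.
by rewrite /= !nth_nil /incident !big_pred0 //= => f; rewrite take0 !inE.
Qed.

Lemma input_size : size s = #|E|.
Proof. by rewrite -size_edges size_map. Qed.

Lemma take_edges j q : (j < #|E|)%N -> q = nth finset.set0 es j ->
  q \in E /\ pos q = j /\ q \notin [set f in take j es]%SET /\
  [set f in take j.+1 es]%SET = (q |: [set f in take j es])%SET.
Proof.
move=> jE qE; have js : (j < size es)%N by rewrite size_edges.
have pq : pos q = j by rewrite qE index_uniq ?uniq_edges.
split; first by rewrite -mem_edges qE mem_nth.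
split=> //; split; first by rewrite inE in_take_leq ?pq ?ltnn // ltnW.
apply/finset.setP => f.
by rewrite !inE (take_nth finset.set0) // mem_rcons inE -qE.
Qed.

Lemma take_edges_sub j : [set f in take j es]%SET \subset E.
Proof. by apply/fintype.subsetP => f; rewrite inE => /mem_take; rewrite mem_edges. Qed.

Lemma add_edge_loading k st : loading k st -> beval st edges_left ->
  runs B add_edge (wcost add_edge)
    (fun st' => exists2 k', (k' < k)%N & loading k' st') st.
Proof.
move=> [j [jk [i0 i1 i2 r0 r1] v0 tab [v1 v2 r3 r4]]].
rewrite /= i0 v0 /= -ltnNge input_size => jE.
have [qE [pq [qF Fq]]] := take_edges jE erefl.
set q := nth _ _ _ in qE pq qF Fq.
have [u [w [iu iw uw quw]]] := input_endpoints qE.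
rewrite pq in iu iw.
have FE := take_edges_sub j.+1; rewrite Fq in FE.
set F := [set f in take j es]%SET in tab qF FE Fq.
have tab3 x : incident (q |: F)%SET x (fun=> 1%N) =
    (imem st 3 x + ((x == u) || (x == w)))%N.
  rewrite incidentU1 // (tab x).1 quw !inE.
  by case: (_ || _).
have tab4 x : incident (q |: F)%SET x (fun f => pos f) =
    (imem st 4 x + (if (x == u) || (x == w) then j else 0))%N.
  by rewrite incidentU1 // (tab x).2 pq quw !inE.
have u3 := incident1_bound u FE; rewrite tab3 eqxx /= in u3.
have w3 := incident1_bound w FE; rewrite tab3 eqxx orbT /= in w3.
have u4 := incident_pos_bound u FE; rewrite tab4 eqxx /= in u4.
have w4 := incident_pos_bound w FE; rewrite tab4 eqxx orbT /= in w4.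
apply: wp_runs; rewrite /= /upd /= !i1 !i2 !v0 iu iw /=.
have vE (a b : 'I_n) : (a == b :> nat) = (a == b) by [].
(* As [u] and [w] differ, the update at [u] leaves the cells read at [w] intact. *)
rewrite vE (eq_sym w) (negbTE uw); do 4!split=> //.
have jB : (j + 1 <= B)%N by rewrite addn1; exact/leq_sqr/(leq_trans jE)/leq_addl.
split=> //; exists k.-1; first by lia.
exists (j + 1)%N; split=> //; [lia|].
rewrite addn1 Fq => x /=; rewrite tab3 tab4 !vE.
by case: (x =P w) => [->|_]; rewrite ?orbT //; case: (x =P u) => [->|_]; rewrite ?addn0.
Qed.

(** * The loop that deletes pendant edges *)

Definition pendant F x : bool :=
  (incident F x (fun=> 1%N) == 1%N) && (incident F x (fun f => pos f) != pos e).

(** At degree 1 the position sum is the position of the only edge, so the second test says that this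
    edge is not [e]. *)
Lemma pendant_spec F v : F \subset E -> pendant F v ->
  exists q p, [/\ v != p, q = [set v; p]%SET, q \in F, q != e
    & forall f, f \in F -> v \in f -> f = q].
Proof.
move=> FE /andP[/eqP/incident1_unique[q [qF vq uq]]].
rewrite (incident_unique _ qF vq uq) => qe.
have qE := fintype.subsetP FE _ qF.
have [p vp qvp] := simple_edge sE qE vq.
exists q, p; split=> //.
by apply: contraNneq qe => ->.
Qed.

Lemma input_other_endpoint q v p : q \in E -> v != p -> q = [set v; p]%SET ->
  (imem inp 1 (pos q) + imem inp 2 (pos q) - v)%N = p.
Proof.
move=> qE vp qvp; have [u [w [-> -> uw quw]]] := input_endpoints qE.
have : v \in q by rewrite qvp !inE eqxx.
have : p \in q by rewrite qvp !inE eqxx orbT.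
rewrite quw !inE => /orP[]/eqP pE /orP[]/eqP vE; rewrite -?pE -?vE.
- by rewrite pE vE eqxx in vp.
- by rewrite addnK.
- by rewrite addKn.
- by rewrite pE vE eqxx in vp.
Qed.

Lemma no_pendant F : F \subset E -> e \in F -> (forall x, ~~ pendant F x) ->
  F = [set e]%SET.
Proof.
move=> FE eF np; apply/eqP; rewrite finset.eqEsubset finset.sub1set eF andbT.
apply/fintype.subsetP => f fF; rewrite inE; apply/negPn/negP => fe.
have sF : simple_graph F by move=> f' /(fintype.subsetP FE)/sE.
have [v [p [_ qF qe uq]]] := pendant_edge sF (acyclicS FE aE) fF fe.
have vq : v \in [set v; p]%SET by rewrite !inE eqxx.
case/negP: (np v); rewrite /pendant !(incident_unique _ qF vq uq) eqxx /=.
by apply: contraNneq qe => /index_inj ->; rewrite ?mem_edges // (fintype.subsetP FE).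
Qed.

(* k bounds the number of remaining iterations: each one deletes an edge or
   advances the scan. *)
Definition pruning (k : nat) st : Prop := exists F (i v : nat) gm gM,
  [/\ [/\ (n - i + #|F|)%N = k, (i <= n)%N, (if (i < n)%N then v < n else v == n)%N,
         F \subset E & e \in F],
      [/\ loaded st, imem st 6 1 = i, imem st 6 2 = v & tabulated F st],
      (forall x, rmem st 3 x = gm x /\ rmem st 4 x = gM x),
      envelope E F e l h gm gM
    & forall x, (x <= i)%N -> x != v :> nat -> ~~ pendant F x].

Lemma loading_pruning k st : loading k st -> ~~ beval st edges_left ->
  pruning (n + #|E|) st.
Proof.
move=> [j [jk ld v0 tab [v1 v2 r3 r4]]]; case: (ld) => i0 _ _ _ _.
rewrite /= i0 v0 /= negbK input_size => Ej.
have {jk Ej} jE : j = #|E| by lia.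
exists E, 0%N, 0%N, (fun=> 0), (fun=> 0); split=> //.
- split; rewrite ?subn0 //.
  have /set0Pn[x _] : e != finset.set0 by rewrite -card_gt0 sE.
  by rewrite (leq_trans _ (ltn_ord x)).
- split=> //; move: tab; rewrite jE -size_edges take_size.
  by congr tabulated; apply/finset.setP => f; rewrite inE mem_edges.
- exact: envelope_init.
- by move=> x; rewrite leqn0 => ->.
Qed.

(** When the comparison fails, storing the maximum rewrites a cell with its own value, so both
    branches end in the same state. *)
Lemma wp_raise (x b y : nat) (Q : state R -> Prop) st :
  wp B (raise x b y) Q st =
  Q (State (imem st) (upd (rmem st) x (imem st 6 4)
    (Num.max (rmem st x (imem st 6 4))
       (rmem st b (imem st 6 3) - rmem st y (imem st 6 2))))).
Proof.
rewrite /=; case: leP => [//|_]; congr Q; case: st => im rm /=; congr State.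
apply/funext => y'; apply/funext => j; rewrite /upd.
by case: ifP => // /andP[/eqP -> /eqP ->].
Qed.

Lemma prune_pruning k st : pruning k st -> beval st vertices_left ->
  runs B prune (wcost prune)
    (fun st' => exists2 k', (k' < k)%N & pruning k' st') st.
Proof.
move=> [F [i [v0 [gm [gM [[kE iN vN FE eF] [ld v1 v2 tab] rg env np]]]]]].
case: (ld) => i0 i1 i2 r0 r1.
rewrite /= i0 v1 /= -ltnNge => iltn; rewrite iltn in vN.
pose v := Ordinal vN.
have tst : beval st is_pendant = pendant F v.
  rewrite /= v2 i0 (tab v).1 (tab v).2 /= -!eqn_leq.
  by rewrite /pendant.
apply: wp_runs; set Q := (Q in wp _ _ Q _).
suff: if pendant F v then wp B remove_pendant Q st else wp B next_vertex Q st.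
  by rewrite -tst.
case: ifPn => pv; last first.
  rewrite /= /upd /= v1; have iB : (i + 1 <= B)%N.
    by rewrite addn1; exact/leq_sqr/(leq_trans iltn)/leq_addr.
  split=> //; split=> //; exists k.-1; first by lia.
  exists F, (i + 1)%N, (i + 1)%N, gm, gM; split=> //.
    by split=> //; [lia|lia|case: ltnP => //; lia].
  (* The new scan position is the current vertex, hence exempt; the old [v] has just failed the
     test. *)
  move=> x xi xv; have [->//|xv'] := eqVneq x v.
  by apply: np; [lia|].
have [q [p [vp qvp qF qe uq]]] := pendant_spec FE pv.
have qE := fintype.subsetP FE _ qF.
have vq : v \in q by rewrite qvp !inE eqxx.
have posq : imem st 4 v = pos q by rewrite (tab v).2 (incident_unique _ qF vq uq).
have pE : (imem st 1 (pos q) + imem st 2 (pos q) - v0)%N = p.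
  by rewrite i1 i2 -(input_other_endpoint qE vp qvp).
have [lq hq] : rmem st 0 (pos q) = l q /\ rmem st 1 (pos q) = h q.
  by rewrite r0 r1; exact: input_bounds.
(* The two conditionals are kept opaque while the rest is simplified, which
   would otherwise duplicate the continuation for each outcome. *)
have [c1 c1E] : {c | c = raise 3 0 4} by exists (raise 3 0 4).
have [c2 c2E] : {c | c = raise 4 1 3} by exists (raise 4 1 3).
rewrite /remove_pendant -c1E -c2E /= /upd /= v2 posq /= pE.
rewrite c1E wp_raise c2E wp_raise /= /upd /=.
have vE (a b : 'I_n) : (a == b :> nat) = (a == b) by [].
have xv0 x : (x == v0 :> nat) = (x == v) by [].
have pv' : (p == v :> nat) = false by rewrite vE eq_sym (negbTE vp).
have v2' : imem st 6 2 = v by [].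
rewrite !v2' pv' eq_sym pv' lq hq !(rg p).1 !(rg p).2 !(rg v).1 !(rg v).2.
have inF' x G : incident F x G = (incident (F :\ q)%SET x G +
    (if (x == v) || (x == p) then G q else 0))%N.
  by rewrite (incidentD1 _ _ qF) qvp !inE.
have b3 x := incident1_bound x FE; have b4 x := incident_pos_bound x FE.
have pB : (p <= B)%N by exact/leq_sqr/(leq_trans (ltnW (ltn_ord p)))/leq_addr.
rewrite !(tab p).1 !(tab p).2 !(tab v).1 !(tab v).2.
have sB a b : (a <= B)%N -> (a - b <= B)%N by exact/leq_trans/leq_subr.
split; first by rewrite -posq (tab v).2.
split=> //; do 4!(split; first exact: sB); split=> //.
have cF : #|F| = (#|(F :\ q)%SET|).+1 by rewrite (cardsD1 q) qF.
exists (n - i + #|(F :\ q)%SET|)%N; first by rewrite -kE cF addnS.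
exists (F :\ q)%SET, i, (p : nat).
exists (fun x => if x == p then Num.max (gm p) (l q - gM v) else gm x).
exists (fun x => if x == p then Num.max (gM p) (h q - gm v) else gM x).
split.
- split=> //; [by rewrite iltn| |by rewrite !inE eq_sym qe].
  exact: fintype.subset_trans (subD1set _ _) FE.
- split=> // x /=; rewrite !vE !xv0 !(tab x).1 !(tab x).2 !inF' !eqxx !orbT.
  case: (x =P p) => [->|_]; first by rewrite ?eqxx ?orbT !addnK.
  case: (x =P v) => [->|_]; first by rewrite ?eqxx !addnK.
  by rewrite !addn0.
- by move=> x /=; rewrite !vE !(rg x).1 !(rg x).2; case: (x == p).
- exact: (envelope_leaf FE lh vp qvp qF qe uq).
(* Now [v] has degree 0 and [p] is the exempt current vertex; nothing changes at the other
   vertices. *)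
- move=> x xi xp; have [->|xv] := eqVneq x v.
    rewrite /pendant; suff -> : incident (F :\ q)%SET v (fun=> 1%N) = 0%N by [].
    have := inF' v (fun=> 1%N); rewrite (incident_unique _ qF vq uq) eqxx /=.
    by lia.
  have := np x xi xv; rewrite /pendant !inF' (negbTE xv).
  by move: xp; rewrite vE => /negbTE ->; rewrite !addn0.
Qed.

Lemma write_output_bounds k st : pruning k st -> ~~ beval st vertices_left ->
  runs B (Seq (write_output 0 3) (write_output 1 4))
    (wcost (Seq (write_output 0 3) (write_output 1 4)))
    (fun st' => output st' = (inf (thresholds E e l h), sup (thresholds E e l h)))
    st.
Proof.
move=> [F [i [v [gm [gM [[_ iN vN FE eF] [ld v1 _ _] rg env np]]]]]].
case: (ld) => i0 i1 i2 _ _.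
rewrite /= i0 v1 /= negbK => ni; rewrite ltnNge ni /= in vN.
(* After the scan the current value is [n], which is no vertex, so no vertex is exempt from being
   non-pendant. *)
have FE1 : F = [set e]%SET.
  apply: no_pendant => // x; apply: np; first exact: leq_trans (ltnW (ltn_ord x)) ni.
  by rewrite (eqP vN) neq_ltn ltn_ord.
have [a [b [ia ib ab eab]]] := input_endpoints eE.
rewrite FE1 in env; have [-> ->] := envelope_set1 ab eab env.
apply: wp_runs; rewrite /= /output /upd /= !i0 i1 i2.
have -> : imem inp 0 2 = pos e by [].
by rewrite ia ib !(rg a).1 !(rg a).2 !(rg b).1 !(rg b).2.
Qed.

Lemma threshold_bounds_runs :
  runs B threshold_bounds
    (((bcost edges_left + wcost add_edge) * #|E| + bcost edges_left) +
     (((bcost vertices_left + wcost prune) * (n + #|E|) + bcost vertices_left) +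
      wcost (Seq (write_output 0 3) (write_output 1 4))))
    (fun st => output st = (inf (thresholds E e l h), sup (thresholds E e l h)))
    inp.
Proof.
apply: runs_seq (runs_while add_edge_loading input_loading) _.
move=> st [[k /loading_pruning Ik] /Ik Ip].
apply: runs_seq (runs_while prune_pruning Ip) _.
by move=> st' [[k' Ik'] ?]; exact: write_output_bounds Ik' _.
Qed.

End Correctness.

Theorem theorem7p1 (R : realType) :
  exists (P : cmd) (C k : nat),
  forall (n : nat) (E : {set {set 'I_n}}) (l h : {set 'I_n} -> R)
         (e : {set 'I_n}) (s : seq ('I_n * 'I_n)),
    is_tree E ->
    (forall f : {set 'I_n}, f \in E -> l f <= h f) ->
    e \in E ->
    edge_list E s ->
    exists (t : nat) (st : state R),
      [/\ exec ((n + #|E|) ^ k)%N P (input s l h e) t st,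
          (t <= C * (n + #|E|))%N
        & output st = (inf (thresholds E e l h), sup (thresholds E e l h))].
Proof.
pose C1 := (bcost edges_left + wcost add_edge)%N.
pose C2 := (bcost vertices_left + wcost prune)%N.
pose C3 := (bcost edges_left + (bcost vertices_left +
  wcost (Seq (write_output 0 3) (write_output 1 4))))%N.
exists threshold_bounds, (C1 + C2 + C3)%N, 2%N => n E l h e s tE lh eE Es.
case: tE => sE _ _ aE.
have [t [st [ex tT out]]] := threshold_bounds_runs sE aE lh eE Es.
exists t, st; split=> //; apply: leq_trans tT _.
(* The size is positive, so the fixed cost [C3] is absorbed into a multiple of it. *)
have E0 : (0 < #|E|)%N by apply/card_gt0P; exists e.
rewrite -/C1 -/C2; move: E0; rewrite /C3; move: C1 C2 => C1 C2.
move: (bcost _) (bcost _) (wcost _) => b1 b2 b3; nia.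
Qed.
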